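(* As $n\to\infty$, we have $$p(n,n)\le \exp\left(\sqrt2\,n\log n+\sqrt2\,\gamma n+O\!\left(\frac{n}{\log n}\right)\right),$$ where $\gamma\approx 0.5772$ is the Euler--Mascheroni constant.
   Context: For positive integers $m,n$, let $R=[0,m]\times[0,n]\subset\mathbb{R}^2$. All rectangles have sides parallel to the coordinate axes. A partition of the rectangle $R$ is a multiset of rectangles $\{R_i\}_{i\in I}$ such that: (1) each $R_i$ has positive integer side lengths; (2) rectangles of sizes $k\times l$ and $l\times k$ are regarded as indistinguishable; (3) all the rectangles of the multiset can be arranged so that they cover exactly $R$ and their interiors are pairwise disjoint. Two partitions are the same if they are equal as multisets (of rectangle types, up to rotation); the geometric arrangement is irrelevant. $p(m,n)$ denotes the number of partitions of the $m\times n$ rectangle. *)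

(* Defs.v *)
From HB Require Import structures.
From mathcomp Require Import all_boot all_order all_algebra.
From mathcomp Require Import finmap multiset.
From mathcomp Require Import all_classical all_reals all_analysis.

Set Implicit Arguments.
Unset Strict Implicit.
Unset Printing Implicit Defensive.

Import Order.TTheory GRing.Theory Num.Theory.
Import numFieldNormedType.Exports.

Local Open Scope classical_set_scope.
Local Open Scope ring_scope.

(* The corner of a placed rectangle is an arbitrary point of the plane; only
   the side lengths are integers. *)
Record rectangle (R : realType) := Rectangle {
  corner : R * R;
  width : nat;
  height : nat }.

Definition region (R : realType) (r : rectangle R) : set (R * R) :=
  `[(corner r).1, (corner r).1 + (width r)%:R] `*`
  `[(corner r).2, (corner r).2 + (height r)%:R].

(* The unordered pair of side lengths is represented as (shorter, longer),
   so that k x l and l x k rectangles have the same shape. *)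
Definition shape (R : realType) (r : rectangle R) : nat * nat :=
  (minn (width r) (height r), maxn (width r) (height r)).

Definition is_tiling (R : realType) (m n N : nat) (r : 'I_N -> rectangle R) :=
  [/\ forall i, (0 < width (r i))%N /\ (0 < height (r i))%N,
      \bigcup_(i in [set: 'I_N]) region (r i) =
        `[(0 : R), m%:R] `*` `[(0 : R), n%:R] &
      forall i j, i != j -> (region (r i))° `&` (region (r j))° = set0].

Definition partitions (R : realType) (m n : nat) : set {mset nat * nat}%mset :=
  [set A | exists N (r : 'I_N -> rectangle R),
     is_tiling m n r /\ A = seq_mset [seq shape (r i) | i : 'I_N]].

(* The cardinal is meaningful by [finite_partitions] below. *)
Definition num_partitions (R : realType) (m n : nat) : nat :=
  #|` fset_set (partitions R m n)|%fset.

(* The limit exists by [cvg_euler_gamma] below. *)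
Definition euler_gamma (R : realType) : R :=
  limn (fun n : nat => \sum_(1 <= k < n.+1) k%:R^-1 - ln n%:R : R).

Lemma tiling_area (R : realType) (m n N : nat) (r : 'I_N -> rectangle R) :
  is_tiling m n r -> (\sum_(i < N) width (r i) * height (r i) <= m * n)%N.
Proof.
case=> pos cover disj.
pose O i : set (R * R) :=
  `](corner (r i)).1, (corner (r i)).1 + (width (r i))%:R[ `*`
  `](corner (r i)).2, (corner (r i)).2 + (height (r i))%:R[.
have O_sub i : O i `<=` region (r i).
  by move=> [x y] [/= hx hy]; split => /=; exact: subset_itv_oo_cc.
have O_open i : open (O i).
  rewrite openE => -[x y] [/= hx hy].
  exists ([set` `](corner (r i)).1, (corner (r i)).1 + (width (r i))%:R[],
          [set` `](corner (r i)).2, (corner (r i)).2 + (height (r i))%:R[]) => //=.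
  by split; apply: open_nbhs_nbhs; split => //; exact: itv_open.
have O_int i : O i `<=` (region (r i))° by rewrite -open_subsetE.
pose mu := (@lebesgue_measure R \x @lebesgue_measure R)%E.
have itvE (a : R) k b c : lebesgue_measure
    [set` Interval (BSide b a) (BSide c (a + k%:R))] = k%:R%:E :> \bar R.
  rewrite lebesgue_measure_itv /= lte_fin ltrDl -EFinB addrC addKr.
  by case: k => [|k]; rewrite ?ltxx// ltr0n.
have O_meas i : measurable (O i).
  by rewrite /O; apply: measurableX; exact: measurable_itv.
have muO i : mu (O i) = (width (r i) * height (r i))%:R%:E.
  rewrite /mu product_measure1E// natrM EFinM.
  by congr (_ * _)%E; exact: itvE.
have muR : mu (`[(0 : R), m%:R] `*` `[(0 : R), n%:R]) = (m * n)%:R%:E.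
  rewrite /mu product_measure1E// natrM EFinM.
  by congr (_ * _)%E; rewrite -[X in `[0, X]]add0r; exact: itvE.
rewrite -(ler_nat R) -lee_fin -muR natr_sum -sumEFin.
under eq_bigr do rewrite -muO.
rewrite -measure_bigsetU_ord//; last first.
  apply/trivIsetP => i j _ _ ij; rewrite -subset0 -(disj _ _ ij).
  exact: setISS.
apply: le_measure; rewrite ?inE.
- by apply: bigsetU_measurable => i _; exact: O_meas.
- by apply: measurableX; exact: measurable_itv.
- apply: (big_ind (fun X => X `<=` _)) => [|X Y XS YS|i _].
  + exact: sub0set.
  + by rewrite subUset.
  + by rewrite -cover => z /O_sub zi; exists i.
Qed.

Lemma finite_partitions (R : realType) (m n : nat) :
  finite_set (partitions R m n).
Proof.
pose K := (m * n).+1.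
pose f (s : (m * n).-bseq ('I_K * 'I_K)) : {mset nat * nat}%mset :=
  seq_mset [seq (val t.1, val t.2) | t <- s].
apply: (@sub_finite_set _ _ (f @` setT)); last first.
  by apply: finite_image; exact: finite_finset.
move=> A [N [r [til ->]]]; have area := tiling_area til.
case: til => pos _ _.
have whK i : (width (r i) * height (r i) < K)%N.
  by rewrite ltnS (leq_trans _ area)// (bigD1 i)//= leq_addr.
have wK i : (width (r i) < K)%N.
  by case: (pos i) => _ h0; rewrite (leq_ltn_trans _ (whK i))// leq_pmulr.
have hK i : (height (r i) < K)%N.
  by case: (pos i) => w0 _; rewrite (leq_ltn_trans _ (whK i))// leq_pmull.
have N_le : (N <= m * n)%N.
  rewrite (leq_trans _ area)// -[X in (X <= _)%N]card_ord -sum1_card.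
  by apply: leq_sum => i _; case: (pos i) => w0 h0; rewrite muln_gt0 w0.
pose s := [seq ((inord (shape (r i)).1 : 'I_K), (inord (shape (r i)).2 : 'I_K)) |
           i : 'I_N].
have s_le : (size s <= m * n)%N by rewrite size_map -cardE card_ord.
exists (Bseq s_le) => //; rewrite /f /= /s -map_comp; congr seq_mset.
apply: eq_map => i /=; rewrite !inordK//=.
  by rewrite gtn_max wK hK.
by rewrite gtn_min wK.
Qed.

Lemma cvg_euler_gamma (R : realType) :
  (fun n : nat => \sum_(1 <= k < n.+1) k%:R^-1 - ln n%:R : R) @ \oo -->
  euler_gamma R.
Proof.
set u := (fun n : nat => _).
have lnS n : ln n.+2%:R = ln n.+1%:R + ln (1 + n.+1%:R^-1) :> R.
  rewrite -lnM ?posrE ?addr_gt0 ?invr_gt0 ?ltr0n//.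
  by rewrite mulrDr mulr1 divff ?pnatr_eq0// natr1.
have lnP n : ln n.+1%:R = ln n.+2%:R + ln (1 - n.+2%:R^-1) :> R.
  have lt1 : n.+2%:R^-1 < 1 :> R by rewrite invf_lt1 ?ltr0n ?ltr1n.
  rewrite -lnM ?posrE ?subr_gt0 ?ltr0n//.
  by rewrite mulrBr mulr1 divff ?pnatr_eq0// -[n.+2%:R]natr1 addrK.
have u_nincr n : u n.+2 <= u n.+1.
  rewrite /u big_nat_recr//= -addrA lerD2l (lnP n).
  have : ln (1 - n.+2%:R^-1) <= - n.+2%:R^-1 :> R.
    by apply: le_ln1Dx; rewrite ltrN2 invf_lt1 ?ltr0n ?ltr1n.
  by rewrite opprD addrC lerD2l lerNr.
have ln_le n : ln n.+1%:R <= \sum_(1 <= k < n.+1) k%:R^-1 :> R.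
  elim: n => [|n IHn]; first by rewrite ln1 big_geq.
  rewrite big_nat_recr//= lnS lerD// le_ln1Dx//.
  by rewrite (lt_le_trans (ltrN10 _))// invr_ge0 ler0n.
have u_ge0 n : 0 <= u n.+1.
  rewrite /u subr_ge0 (le_trans (ln_le n))//.
  by rewrite [leRHS]big_nat_recr//= lerDl invr_ge0 ler0n.
have : cvgn [sequence u (n + 1)%N]_n.
  apply: nonincreasing_is_cvgn; last first.
    by exists 0 => _ [n _ <-]; rewrite /= addn1.
  by apply/nonincreasing_seqP => n; rewrite /= !addn1.
by case/cvg_ex => l; rewrite cvg_shiftn => /cvgP.
Qed.

(* Main.v *)
Require Import Defs.
From HB Require Import structures.
From mathcomp Require Import all_boot all_order all_algebra.
From mathcomp Require Import finmap multiset.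
From mathcomp Require Import all_classical all_reals all_analysis.
From mathcomp Require Import ring lra.

Set Implicit Arguments.
Unset Strict Implicit.
Unset Printing Implicit Defensive.

Import Order.TTheory GRing.Theory Num.Theory.
Import numFieldNormedType.Exports.

Local Open Scope classical_set_scope.
Local Open Scope ring_scope.

(** Forget the geometry of a tiling of the n x n square except for two facts:
    every tile has sides at most [n], and the areas of the tiles add up to at
    most [n * n]. A partition is then a choice of multiplicities [f (k, l)] for
    the shapes [1 <= k <= l <= n] subject to [\sum f (k, l) * k * l <= n * n]
    ([num_partitions_le_codes]).

    Such choices are counted by Rankin's trick, that is, by evaluating the
    generating function [\prod_(k <= l) (1 - x^(k l))^-1] at [x = exp(- t)].
    For every [t > 0], each admissible [f] contributes at least 1 to
    [exp(t n^2) * \sum_f \prod exp(- t k l f (k, l))], the sum over all [f]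
    factors into geometric series, and each of these is at most
    [exp(1 / (t k l))] ([card_weighted_le]). Hence
      [p(n, n) <= exp(t n^2 + t^-1 * \sum_(k <= l) 1 / (k l))].
    By symmetry the last sum is [(H^2 + \sum_k 1 / k^2) / 2 <= (H^2 + 2) / 2],
    where [H] is the [n]-th harmonic number. The two dominant terms [t n^2] and
    [H^2 / (2 t)] balance at [t = H / (sqrt 2 * n)], which yields
      [p(n, n) <= exp(sqrt 2 * n * H + sqrt 2 * n / H)]
    ([num_partitions_le_harmonic]).

    Finally [ln n <= H <= ln n + gamma + 1 / n]. The upper bound turns the first
    term into [sqrt 2 * n * ln n + sqrt 2 * gamma * n + sqrt 2], the lower bound
    makes the second term at most [sqrt 2 * n / ln n], and both remainders are
    [O(n / ln n)]. *)

(** * Counting bounded multiplicity functions *)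

(** With [q = exp(- s)], the inequality [1 + s <= exp s] gives
    [1 / (1 - q) <= 1 + 1 / s], and a second use of it at [1 / s] gives the
    exponential, a form that multiplies well over many series. *)
Lemma geometric_sum_le (R : realType) (s : R) (n : nat) : 0 < s ->
  \sum_(j < n) expR (- (s * j%:R)) <= expR s^-1.
Proof.
move=> s0; set q := expR (- s).
have q1 : q < 1 by rewrite expR_lt1 oppr_lt0.
have sq : q * (1 + s) <= 1.
  by rewrite /q expRN mulrC ler_pdivrMr ?expR_gt0// mul1r expR_ge1Dx.
apply: le_trans (expR_ge1Dx _).
under eq_bigr do rewrite -mulNr expRM_natr -/q.
have : (1 - q) * \sum_(j < n) q ^+ j <= 1.
  have := subrX1 q n; have : 0 <= q ^+ n by rewrite exprn_ge0// expR_ge0.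
  lra.
rewrite mulrC -ler_pdivlMr ?subr_gt0// => /le_trans; apply.
rewrite div1r -[leLHS]mul1r ler_pdivrMr ?subr_gt0//.
have -> : (1 + s^-1) * (1 - q) = 1 + (1 - q * (1 + s)) / s.
  by field; rewrite gt_eqF.
by rewrite lerDl divr_ge0 ?subr_ge0// ltW.
Qed.

(** Rankin's trick: an admissible [f] has
    [exp(t * (N - \sum f i * w i)) >= 1], so summing this quantity over all
    [f], admissible or not, bounds the count; distributivity turns the sum into
    a product of geometric series. Restricting the support to [P] lets ordered
    pairs [k <= l] be handled inside the square index type of all pairs. *)
Lemma card_weighted_le (R : realType) (I : finType) (P : pred I) (w : I -> nat)
    (N : nat) (t : R) : (forall i, 0 < w i)%N -> 0 < t ->
  #|[pred f : {ffun I -> 'I_N.+1} | (f \in pffun_on ord0 P predT) &&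
       (\sum_(i | P i) f i * w i <= N)%N]|%:R
    <= expR (t * N%:R + t^-1 * \sum_(i | P i) (w i)%:R^-1).
Proof.
move=> w0 t0; rewrite -sum1_card natr_sum.
pose rankin (f : {ffun I -> 'I_N.+1}) : R :=
  expR (t * N%:R) * \prod_(i | P i) expR (- (t * (w i)%:R * (f i)%:R)).
apply: (@le_trans _ _ (\sum_(f in pffun_on ord0 P predT) rankin f)).
  (* The inadmissible functions only add nonnegative terms. *)
  rewrite [leRHS](bigID (fun f : {ffun I -> 'I_N.+1} =>
    (\sum_(i | P i) f i * w i <= N)%N))/= -[leLHS]addr0 lerD//; last first.
    apply: sumr_ge0 => f _; apply: mulr_ge0; first exact: expR_ge0.
    by apply: prodr_ge0 => i _; exact: expR_ge0.
  apply: ler_sum => f /andP[_ fN].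
  rewrite /rankin -expR_sum -expRD -[leLHS]expR0 ler_expR sumrN.
  rewrite subr_ge0.
  under eq_bigr do rewrite -mulrA -natrM mulnC.
  by rewrite -mulr_sumr -natr_sum ler_pM2l// ler_nat.
rewrite -mulr_sumr -(big_distr_big ord0 P predT
  (fun i (j : 'I_N.+1) => expR (- (t * (w i)%:R * j%:R)))).
rewrite expRD ler_pM2l ?expR_gt0// mulr_sumr expR_sum.
apply: ler_prod => i _; rewrite sumr_ge0/= => [|j _]; last exact: expR_ge0.
by rewrite -invfM geometric_sum_le// mulr_gt0// ltr0n.
Qed.

(** * Multiplicities of the shapes in a tiling *)

(** Two opposite corners of the tile lie in the tiled rectangle. *)
Lemma tile_sides_le (R : realType) (m n N : nat) (r : 'I_N -> rectangle R) i :
  is_tiling m n r -> (width (r i) <= m)%N /\ (height (r i) <= n)%N.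
Proof.
case=> _ cover _.
have sub : region (r i) `<=` `[(0 : R), m%:R] `*` `[(0 : R), n%:R].
  by rewrite -cover => z zi; exists i.
have c0 : region (r i) (corner (r i)).
  by split; rewrite /= in_itv/= lexx lerDl ler0n.
have c1 : region (r i) ((corner (r i)).1 + (width (r i))%:R,
                        (corner (r i)).2 + (height (r i))%:R).
  by split; rewrite /= in_itv/= lexx lerDl ler0n.
move: (sub _ c0) (sub _ c1) => [/=]; rewrite !in_itv/=.
move=> /andP[x0 _] /andP[y0 _] [/=].
move=> /andP[_ x1] /andP[_ y1]; rewrite -!(ler_nat R).
by split; [move: x0 x1|move: y0 y1]; lra.
Qed.

(** The index [p] stands for the shape [(p.1.+1, p.2.+1)]. Every tile has area
    at least 1, so no multiplicity exceeds [n * n]. *)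
Definition partition_codes (n : nat) :
    pred {ffun 'I_n * 'I_n -> 'I_(n * n).+1} :=
  [pred f | (f \in pffun_on ord0 [pred p : 'I_n * 'I_n | p.1 <= p.2]%N predT) &&
    (\sum_(p : 'I_n * 'I_n | p.1 <= p.2) f p * (p.1.+1 * p.2.+1) <= n * n)%N].

Definition partition_code (n : nat) (A : {mset nat * nat}%mset) :
    {ffun 'I_n * 'I_n -> 'I_(n * n).+1} :=
  [ffun p : 'I_n * 'I_n => inord (A (p.1.+1, p.2.+1))].
Arguments partition_code : clear implicits.

(** Double counting: each tile has its shape at one index at most, and there it
    contributes its own area. *)
Lemma tiling_multiplicity_area (R : realType) (n N : nat)
    (r : 'I_N -> rectangle R) : is_tiling n n r ->
  (\sum_(p : 'I_n * 'I_n | p.1 <= p.2)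
     seq_mset [seq Defs.shape (r i) | i : 'I_N] (p.1.+1, p.2.+1) *
     (p.1.+1 * p.2.+1) <= n * n)%N.
Proof.
move=> til; apply: leq_trans (tiling_area til).
under eq_bigr => p _.
  rewrite mset_seqE -sum1_count big_image_cond/= big_distrl/=.
  over.
rewrite (exchange_big_dep predT)//=; apply: leq_sum => i _.
rewrite (eq_bigr (fun=> width (r i) * height (r i))%N); last first.
  move=> p /andP[_ /eqP[<- <-]]; rewrite mul1n.
  by case: leqP => // _; rewrite mulnC.
rewrite sum_nat_const -[leqRHS]mul1n leq_mul2r; apply/orP; right.
apply/card_le1_eqP => -[p1 p2] [q1 q2] /=.
move=> /andP[_ /eqP->] /andP[_ /eqP[pq1 pq2]].
by congr (_, _); exact: val_inj.
Qed.

(** The codes determine the partition because a multiset of shapes coming from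
    a tiling vanishes outside the range [1 <= k <= l <= n] that they record. *)
Lemma num_partitions_le_codes (R : realType) (n : nat) :
  (num_partitions R n n <= #|@partition_codes n|)%N.
Proof.
pose code := partition_code n.
pose X := fset_set (partitions R n n).
have XP A : A \in X -> partitions R n n A.
  by rewrite in_fset_set ?inE//; exact: finite_partitions.
have mult_lt A (p : 'I_n * 'I_n) : partitions R n n A -> (p.1 <= p.2)%N ->
    (A (p.1.+1, p.2.+1) < (n * n).+1)%N.
  move=> [N [r [til ->]]] p12; rewrite ltnS.
  apply: leq_trans (tiling_multiplicity_area til).
  by rewrite (bigD1 p)//= (leq_trans _ (leq_addr _ _))// leq_pmulr.
have outside N (r : 'I_N -> rectangle R) k l : is_tiling n n r ->
    ~~ [&& 0 < k, k <= l & l <= n]%N ->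
    seq_mset [seq Defs.shape (r i) | i : 'I_N] (k, l) = 0%N.
  move=> til; rewrite mset_seqE => /negP kl; apply/count_memPn/negP.
  move=> /mapP[i _ [kE lE]]; apply: kl.
  have [wn hn] := tile_sides_le i til; case: til => /(_ i)[w0 h0] _ _.
  by rewrite kE lE leq_min w0 h0 geq_max wn hn geq_min leq_max leqnn.
have codeE A p : A \in X -> code A p = A (p.1.+1, p.2.+1) :> nat.
  move=> /XP PA; rewrite ffunE.
  have [p12|p12] := leqP p.1 p.2; first by rewrite inordK// mult_lt.
  case: PA => N [r [til ->]]; rewrite outside// ?inordK//.
  by rewrite !ltnS (leqNgt p.1) p12.
have code_inj : {in X &, injective code}.
  move=> A B AX BX AB; apply/msetP => -[k l].
  have [/and3P[]|kl] := boolP [&& 0 < k, k <= l & l <= n]%N; last first.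
    case: (XP _ AX) (XP _ BX) => N [r [til ->]] [N' [r' [til' ->]]].
    by rewrite !outside.
  case: k l => // k [//|l] _ kl ln; have kn : (k < n)%N := leq_trans kl ln.
  have := codeE _ (Ordinal kn, Ordinal ln) AX.
  by rewrite AB (codeE _ _ BX).
rewrite /num_partitions -/X -(card_in_imfset imfset_key code_inj)/=.
rewrite -card_finset; apply/fsubset_leq_card/fsubsetP => f.
move=> /imfsetP[A /= AX ->]; rewrite !inE; apply/andP; split.
  apply/pffun_onP; split => //; apply/supportP => p; rewrite inE => p12.
  apply: val_inj; rewrite /= codeE//.
  by case: (XP _ AX) => N [r [til ->]]; rewrite outside//= ltnS (negbTE p12).
under eq_bigr do rewrite codeE//.
by case: (XP _ AX) => N [r [til ->]]; exact: tiling_multiplicity_area.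
Qed.

(** * Sums of reciprocals *)

(** The pairs below and above the diagonal contribute equally, and doubling
    counts the diagonal once more than the square of the sum does. *)
Lemma sum_le_mul (R : comPzRingType) (n : nat) (a : 'I_n -> R) :
  (\sum_(p : 'I_n * 'I_n | (p.1 <= p.2)%N) a p.1 * a p.2) *+ 2 =
  (\sum_i a i) ^+ 2 + \sum_i a i ^+ 2.
Proof.
pose F (p : 'I_n * 'I_n) := a p.1 * a p.2.
have swap : \sum_(p : 'I_n * 'I_n | (p.1 <= p.2)%N) F p =
            \sum_(p : 'I_n * 'I_n | (p.2 <= p.1)%N) F p.
  rewrite (reindex_inj (inv_inj (f := fun p => (p.2, p.1)) _))/=; last by case.
  by apply: eq_bigr => p _; rewrite /F mulrC.
have -> : (\sum_i a i) ^+ 2 = \sum_(p : 'I_n * 'I_n) F p.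
  rewrite expr2 big_distrl/=; under eq_bigr do rewrite big_distrr/=.
  by rewrite pair_big.
have -> : \sum_i a i ^+ 2 = \sum_(p : 'I_n * 'I_n | p.1 == p.2) F p.
  rewrite -(pair_big_dep predT (fun i j => i == j) (fun i j => a i * a j))/=.
  by apply: eq_bigr => i _; rewrite (big_pred1 i) ?expr2// => j; rewrite eq_sym.
rewrite mulr2n {2}swap.
rewrite [in RHS](bigID (fun p : 'I_n * 'I_n => (p.1 <= p.2)%N))/= -addrA.
congr (_ + _); rewrite [LHS](bigID (fun p : 'I_n * 'I_n => p.1 == p.2))/= addrC.
congr (_ + _); apply: eq_bigl => -[i j] /=.
  by rewrite -ltnNge ltn_neqAle andbC eq_sym.
by rewrite -val_eqE; case: eqP => [->|]; rewrite ?leqnn ?andbF.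
Qed.

(** Telescoping against [1 / (m (m + 1)) = 1 / m - 1 / (m + 1)]; the induction
    needs the sharper bound [2 - 1 / n]. *)
Lemma sum_inv_sqr_le2 (R : realFieldType) (n : nat) :
  \sum_(i < n) (i.+1%:R^-1) ^+ 2 <= 2 :> R.
Proof.
case: n => [|n]; first by rewrite big_ord0.
suff : \sum_(i < n.+1) (i.+1%:R^-1) ^+ 2 <= 2 - n.+1%:R^-1 :> R.
  by move=> /le_trans; apply; rewrite gerBl invr_ge0.
elim: n => [|n IHn]; first by rewrite big_ord1 invr1 expr1n; lra.
rewrite big_ord_recr/=; apply: le_trans (lerD IHn (lexx _)) _.
rewrite -[n.+2%:R]natr1; set m : R := n.+1%:R; have m0 : 0 < m by rewrite ltr0n.
rewrite -subr_ge0.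
have -> : 2 - (m + 1)^-1 - (2 - m^-1 + (m + 1)^-1 ^+ 2) = (m * (m + 1) ^+ 2)^-1.
  by field; rewrite !gt_eqF//; lra.
by rewrite invr_ge0 mulr_ge0 ?exprn_ge0//; lra.
Qed.

(** One step increases this sequence by [1 / l - ln (1 + 1 / l) >= 0]. The
    correction [1 / m] makes the sequence increase to the Euler--Mascheroni
    constant, whereas [H_m - ln m] decreases to it; this gives the rate of
    convergence [1 / n]. *)
Lemma harmonic_ln_nondecreasing (R : realType) (m n : nat) :
  (0 < m <= n)%N ->
  series harmonic m - ln m%:R - m%:R^-1 <=
  series harmonic n - ln n%:R - n%:R^-1 :> R.
Proof.
move=> /andP[m0 /subnK <-]; elim: (n - m)%N => [//|k IHk].
apply: le_trans IHk _; rewrite addSn; set l := (k + m)%N.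
have l0 : (0 < l)%N by rewrite addn_gt0 m0 orbT.
rewrite /series/= big_nat_recr//= -!addrA lerD2l.
have lV : 0 < l%:R^-1 :> R by rewrite invr_gt0 ltr0n.
have -> : ln l.+1%:R = ln l%:R + ln (1 + l%:R^-1) :> R.
  rewrite -lnM ?posrE ?ltr0n ?addr_gt0//.
  by rewrite mulrDr mulr1 divff ?pnatr_eq0 -?lt0n// natr1.
have : ln (1 + l%:R^-1) <= l%:R^-1 :> R by apply: le_ln1Dx; lra.
rewrite /harmonic/=; move: (l.+1%:R^-1) => y; lra.
Qed.

(** The sequence of [harmonic_ln_nondecreasing] starts at 0 for [m = 1]. *)
Lemma harmonic_ge_ln (R : realType) (n : nat) : (0 < n)%N ->
  ln n%:R <= series harmonic n :> R.
Proof.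
move=> n0; have := @harmonic_ln_nondecreasing R 1 n.
rewrite n0 => /(_ isT); rewrite /series/= big_nat1/= ln1 invr1.
have : 0 <= n%:R^-1 :> R by rewrite invr_ge0.
lra.
Qed.

Lemma harmonic_le_euler_gamma (R : realType) (n : nat) : (0 < n)%N ->
  series harmonic n <= ln n%:R + euler_gamma R + n%:R^-1 :> R.
Proof.
move=> n0.
suff : series harmonic n - ln n%:R - n%:R^-1 <= euler_gamma R by lra.
apply: limr_ge.
  by apply/cvg_ex; exists (euler_gamma R); exact: cvg_euler_gamma.
exists n => // m /= nm; rewrite big_add1/=.
have := @harmonic_ln_nondecreasing R n m; rewrite n0 => /(_ nm).
have : 0 <= m%:R^-1 :> R by rewrite invr_ge0.
rewrite /series/=; lra.
Qed.

(** * The bound on the number of partitions *)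

(** Rankin's bound at the value of the parameter [t] that minimises
    [t n^2 + H^2 / (2 t)]. The second term of the exponent comes from the
    squares [1 / k^2] on the diagonal of [\sum_(k <= l) 1 / (k l)]. *)
Lemma num_partitions_le_harmonic (R : realType) (n : nat) : (0 < n)%N ->
  (num_partitions R n n)%:R <=
    expR (Num.sqrt 2 * n%:R * series harmonic n +
          Num.sqrt 2 * n%:R / series harmonic n) :> R.
Proof.
move=> n0; pose H : R := series harmonic n; rewrite -/H.
have H0 : 0 < H.
  by rewrite /H /series/= big_ltn// invr1 ltr_pwDl// sumr_ge0.
have nR : 0 < n%:R :> R by rewrite ltr0n.
set s : R := Num.sqrt 2; have s0 : 0 < s by rewrite sqrtr_gt0.
have s2 : s ^+ 2 = 2 by rewrite sqr_sqrtr.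
have sV : s^-1 = s / 2 by rewrite -s2 expr2 invfM mulrA divff ?mul1r// gt_eqF.
pose t := H / (s * n%:R); have t0 : 0 < t by rewrite divr_gt0// mulr_gt0.
have wP (p : 'I_n * 'I_n) : (0 < p.1.+1 * p.2.+1)%N by [].
have := num_partitions_le_codes R n; rewrite -(ler_nat R) => /le_trans; apply.
apply: le_trans (card_weighted_le _ _ wP t0) _; rewrite ler_expR.
set S := \sum_(p | _) _.
have S2 : S *+ 2 <= H ^+ 2 + 2.
  rewrite /S; under eq_bigr do rewrite natrM invfM.
  rewrite (sum_le_mul (fun i : 'I_n => i.+1%:R^-1)) /H /series/= big_mkord.
  by rewrite lerD2l sum_inv_sqr_le2.
have -> : s * n%:R * H + s * n%:R / H =
    t * (n * n)%:R + t^-1 * ((H ^+ 2 + 2) / 2).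
  rewrite /t invf_div natrM invfM sV.
  by field; rewrite !gt_eqF.
rewrite lerD2l ler_pM2l ?invr_gt0//.
by rewrite ler_pdivlMr// mulr_natr.
Qed.

Theorem theorem1p4 (R : realType) :
  exists g : nat -> R,
    g =O_\oo (fun n : nat => n%:R / ln n%:R : R) /\
    \forall n \near \oo,
      (num_partitions R n n)%:R <= expR (Num.sqrt 2 * n%:R * ln n%:R
                            + Num.sqrt 2 * euler_gamma R * n%:R + g n).
Proof.
set s : R := Num.sqrt 2; have s0 : 0 < s by rewrite sqrtr_gt0.
(* One [s * (n / ln n)] absorbs the diagonal term [s * n / H], the other absorbs
   [s * n * (1 / n)], the error in the approximation of [H]. *)
exists (fun n => 2 * s * (n%:R / ln n%:R)); split.
  apply/eqO_exP; exists (2 * s); first by rewrite mulr_gt0.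
  by apply: nearW => n; rewrite normrM ger0_norm// mulr_ge0// ltW.
exists 2%N => // n /= n2; have n0 : (0 < n)%N by exact: ltnW.
apply: le_trans (num_partitions_le_harmonic R n0) _; rewrite -/s ler_expR.
have Hge := harmonic_ge_ln R n0; have Hle := harmonic_le_euler_gamma R n0.
have nR : 0 < n%:R :> R by rewrite ltr0n.
have L0 : 0 < ln n%:R :> R by rewrite ln_gt0 ?ltr1n.
have Ln : ln n%:R <= n%:R :> R.
  have := @le_ln1Dx R (n%:R - 1); rewrite subrKC; lra.
move: (series _ _) Hge Hle => H Hge Hle.
have main : s * n%:R * H <= s * n%:R * ln n%:R + s * euler_gamma R * n%:R + s.
  rewrite [leRHS](_ : _ = s * n%:R * (ln n%:R + euler_gamma R + n%:R^-1)).
    by rewrite ler_pM2l// mulr_gt0.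
  by field; rewrite gt_eqF.
have e1 : s <= s * (n%:R / ln n%:R).
  by rewrite ler_pMr// ler_pdivlMr// mul1r.
have e2 : s * n%:R / H <= s * (n%:R / ln n%:R).
  rewrite -mulrA ler_pM2l// ler_pM2l// lef_pV2 ?posrE//.
  exact: lt_le_trans Hge.
lra.
Qed.
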